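(* Let $n = p_1^{c_1} \cdots p_k^{c_k}$, where $k \ge 1$, $p_1, \dots, p_k$ are distinct odd primes and each $c_i \ge 1$. Assume that either of the following two conditions holds: (i) $c_1 + \cdots + c_k$ is even; (ii) $c_1 + \cdots + c_k$ is odd and there exists $1 \le \ell \le k$ such that $p_\ell \equiv 1 \pmod 4$ and $c_\ell$ is odd. Then $h(n) = (n-1)/2$.
   Context: $A_n$ is the alternating group of degree $n$, acting on $\mathbb{Z}_n = \mathbb{Z}/n\mathbb{Z} = \{0,1,\ldots,n-1\}$. Permutations act on the right (the image of $x$ under $\pi$ is $x^\pi$) and are composed from left to right. For $n$ odd, let $c = (0,1,\ldots,n-1) \in A_n$, i.e. $x^c = x+1$. For $\pi \in A_n$, $[\pi] = \langle c\rangle \pi$ is the coset of $\langle c \rangle$ containing $\pi$; its elements are the permutations $c^j\pi$ (first $c^j$, then $\pi$). Define $h(\pi)$ to be the minimum number of 3-cycles in an expression of $\pi$ as a product of (not necessarily disjoint) 3-cycles in $A_n$, with $h(\mathrm{id}) = 0$. Define $h([\pi]) = \min_{\sigma \in [\pi]} h(\sigma) = \min_{0 \le j \le n-1} h(c^j\pi)$ and $h(n) = \max_{\pi \in A_n} h([\pi])$. *)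

(* Defs.v *)
From mathcomp Require Import all_boot all_algebra all_fingroup all_solvable.

Set Implicit Arguments.
Unset Strict Implicit.
Unset Printing Implicit Defensive.

Import GroupScope.

Section ThreeCycles.

Variable T : finType.
Implicit Type s : {perm T}.

Definition three_cycle s : bool :=
  [exists a, exists b, exists d,
    [&& uniq [:: a; b; d], s a == b, s b == d, s d == a
      & [forall x, (x \notin [:: a; b; d]) ==> (s x == x)]]].

Definition prod_three_cycles s (m : nat) : bool :=
  [exists t : m.-tuple {perm T}, all three_cycle t && (s == \prod_(u <- t) u)].

Lemma prod_three_cycles1 : prod_three_cycles 1 0.
Proof. by apply/existsP; exists [tuple]; rewrite /= big_nil. Qed.

Lemma prod_three_cycles_single s : three_cycle s -> prod_three_cycles s 1.
Proof.
by move=> cs; apply/existsP; exists [tuple s]; rewrite /= cs big_seq1 eqxx.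
Qed.

Lemma prod_three_cyclesM s t m k :
  prod_three_cycles s m -> prod_three_cycles t k ->
  prod_three_cycles (s * t) (m + k).
Proof.
move=> /existsP[u /andP[au /eqP->]] /existsP[v /andP[av /eqP->]].
by apply/existsP; exists [tuple of u ++ v]; rewrite /= all_cat au av big_cat /=.
Qed.

Lemma three_cycle_tpermM (a b d : T) :
  uniq [:: a; b; d] -> three_cycle (tperm a b * tperm a d).
Proof.
move=> Uabd; apply/existsP; exists a; apply/existsP; exists b.
apply/existsP; exists d; rewrite Uabd; move: Uabd.
rewrite /= !inE !negb_or andbT => /andP[/andP[ab ad] bd].
have db : d != b by rewrite eq_sym.
rewrite !permM tpermL tpermR tpermL (tpermD ad bd) tpermR (tpermD ab db).
rewrite !eqxx /=.
apply/forallP=> x; apply/implyP; rewrite !inE !negb_or => /and3P[xa xb xd].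
by rewrite permM !tpermD // eq_sym.
Qed.

Lemma tpermM_prod_three_cycles (a b x y : T) :
  a != b -> x != y -> exists m, prod_three_cycles (tperm a b * tperm x y) m.
Proof.
have shared (u v w : T) : u != v -> u != w ->
    exists m, prod_three_cycles (tperm u v * tperm u w) m.
  move=> uv uw; have [<-|vw] := eqVneq v w.
    by exists 0%N; rewrite tperm2 prod_three_cycles1.
  exists 1%N; apply/prod_three_cycles_single/three_cycle_tpermM.
  by rewrite /= !inE !negb_or uv uw vw.
move=> ab xy; have [ax|ax] := eqVneq a x; first by subst x; exact: shared.
have [m pm] := shared a b x ab ax.
have [k pk] : exists k, prod_three_cycles (tperm x a * tperm x y) k.
  by apply: shared => //; rewrite eq_sym.
exists (m + k)%N; have := prod_three_cyclesM pm pk.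
by rewrite (tpermC x a) -mulgA [tperm a x * (_ * _)]mulgA tperm2 mul1g.
Qed.

Lemma Alt_prod_three_cycles s :
  s \in 'Alt_T -> exists m, prod_three_cycles s m.
Proof.
rewrite Alt_even; case: (prod_tpermP s) => ts -> dts.
rewrite odd_perm_prod //.
have [r] := ubnP (size ts); elim: r ts dts => // r IHr [|u [|v ts]] //=.
  by move=> *; exists 0%N; rewrite big_nil prod_three_cycles1.
move=> /and3P[du dv dts]; rewrite !ltnS negbK => /ltnW lt_r even_ts.
have [m pm] := tpermM_prod_three_cycles du dv.
have [k pk] := IHr ts dts lt_r even_ts.
by exists (m + k)%N; rewrite !big_cons mulgA prod_three_cyclesM.
Qed.

Fact hperm_subproof s :
  exists m, (s \in 'Alt_T) ==> prod_three_cycles s m.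
Proof.
have [/Alt_prod_three_cycles[m pm]|_] := boolP (s \in 'Alt_T); last by exists 0%N.
by exists m.
Qed.

(* The implication only makes [hperm] total: odd permutations, which have no
   such expression, get the value 0. *)
Definition hperm s : nat := ex_minn (hperm_subproof s).

End ThreeCycles.

Section Cosets.

(* 'Z_n has exactly n elements only for 1 < n. *)
Variable n : nat.

Definition cshift : {perm 'Z_n} := perm (@GRing.addIr _ (1%R : 'Z_n)).

(* Products in {perm _} compose from left to right. *)
Definition hcoset (pi : {perm 'Z_n}) : nat :=
  hperm [arg min_(s < pi in <[cshift]> :* pi) hperm s].

Definition h : nat := \max_(pi in 'Alt_('Z_n)) hcoset pi.

End Cosets.

(* Main.v *)
(* Lower bound: glueing points along the supports of m 3-cycles gives blocks
   stable under their product s, and each 3-cycle lowers the number of blocks of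
   odd size by at most 2.  A block of odd size contains a cycle of s of odd
   length, so if s has at most one such cycle then #|T| <= 2 m + 1.

   Let pi be x |-> a x on Z/n.  Every c^j pi is affine of slope a, and two points
   x, y fixed by its k-th power satisfy (a^k - 1)(x - y) = 0.  If a has even order
   modulo every prime divisor of n, then a^k - 1 is a unit for k odd, and c^j pi
   has at most one cycle of odd length.  The sign of x |-> a x is multiplicative
   in the odd modulus n (Zolotarev), so a primitive root modulo each p_i gives a
   permutation of sign (-1)^(c_1 + ... + c_k); if this is odd, one uses instead
   the square of a primitive root modulo p_l, whose order (p_l - 1)/2 is even. *)

Require Import Defs.
From mathcomp Require Import all_boot all_algebra all_fingroup all_solvable.

Set Implicit Arguments.
Unset Strict Implicit.
Unset Printing Implicit Defensive.

(** * Odd blocks and the lower bound on the number of 3-cycles *)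

Lemma odd_sum_odd (I : finType) (A : {set I}) (F : I -> nat) :
  (forall i, i \in A -> odd (F i)) -> odd (\sum_(i in A) F i) = odd #|A|.
Proof.
move=> oddF; rewrite -sum1_card; elim/big_rec2: _ => // i m k Ai.
by rewrite !oddD oddF // => ->.
Qed.

Lemma card_preimset_sum (T U : finType) (f : T -> U) (A : {set U}) :
  #|f @^-1: A| = \sum_(v in A) #|f @^-1: [set v]|.
Proof.
rewrite -sum1_card (partition_big f (mem A)) => [|x]; rewrite ?inE //=.
apply: eq_bigr => v Av; rewrite -sum1_card; apply: eq_bigl => x.
by rewrite !inE; case: eqP => [->|]; rewrite ?Av ?andbF.
Qed.

Definition odd_fibres {T U : finType} (f : T -> U) : {set U} :=
  [set v | odd #|f @^-1: [set v]|].

(** Here [g] collapses the values at x, y, z to [f x], leaving all other fibres alone. If at most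
    two of the collapsed fibres were odd, at most two are lost; if three were, their union has odd
    size, and again only two are lost. *)
Lemma merge_fibres (T U : finType) (f : T -> U) (x y z : T) :
  exists g : T -> U,
    [/\ forall u v, f u = f v -> g u = g v, g x = g y, g x = g z
      & #|odd_fibres f| <= #|odd_fibres g| + 2].
Proof.
pose S := [set f x; f y; f z].
pose g u := if f u \in S then f x else f u.
exists g; split; rewrite /g ?inE ?eqxx ?orbT //; first by move=> u v ->.
have gDS : odd_fibres g :\: S = odd_fibres f :\: S.
  apply/setP=> v; rewrite !in_setD; case Sv: (v \in S) => //=.
  rewrite !inE; congr (odd _); apply: eq_card => u; rewrite !inE /g.
  case: ifP => // Su; have fxS: f x \in S by rewrite !inE eqxx.
  by apply/eqP/eqP => e; move: Sv; rewrite -e ?fxS ?Su.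
rewrite -(cardsID S (odd_fibres f)) -(cardsID S (odd_fibres g)) gDS.
rewrite -addnAC leq_add2r.
have S3 : #|S| <= 3.
  rewrite (leq_trans (leq_card_setU _ _)) // cards1 addn1 ltnS.
  by rewrite (leq_trans (leq_card_setU _ _)) // !cards1.
have [|gt2] := leqP #|odd_fibres f :&: S| 2; first by move/leq_trans->; rewrite ?leq_addl.
have le3 := leq_trans gt2 (subset_leq_card (subsetIr _ _)).
have cS : #|S| = 3 by apply/eqP; rewrite eqn_leq S3.
have SO : S \subset odd_fibres f.
  by apply/setIidPr/eqP; rewrite eqEcard subsetIr cS.
rewrite (leq_trans (subset_leq_card (subsetIr _ _))) // cS.
rewrite -[3]/(1 + 2) leq_add2r card_gt0; apply/set0Pn; exists (f x).
rewrite !inE eqxx andbT.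
have -> : g @^-1: [set f x] = f @^-1: S.
  apply/setP=> u; rewrite !inE -/(f u) /g; case: ifP; rewrite !inE ?eqxx //.
  by move=> /negbT; rewrite !negb_or -andbA => /and3P[/negPf -> /negPf-> /negPf->].
rewrite card_preimset_sum odd_sum_odd ?cS // => v /(subsetP SO).
by rewrite inE.
Qed.

(** The induction starts from the identity, whose fibres are singletons, hence all odd; each 3-cycle
    then merges the fibres of its three points. *)
Lemma three_cycles_fibres (T : finType) (ts : seq {perm T}) :
  all (@three_cycle T) ts ->
  exists f : T -> T,
    (forall t x, t \in ts -> f (t x) = f x)
    /\ #|T| <= #|odd_fibres f| + (size ts).*2.
Proof.
elim: ts => [_|t ts IH /= /andP[ct /IH[f [finv fodd]]]].
  exists id; split=> //; rewrite addn0 -cardsT subset_leq_card //.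
  apply/subsetP=> v _; rewrite !inE.
  have -> : id @^-1: [set v] = [set v] by apply/setP=> u; rewrite !inE.
  by rewrite cards1.
case/existsP: ct => a /existsP[b /existsP[d]].
case/and5P=> _ /eqP ta /eqP tb /eqP td /forallP tfix.
have [g [gf gab gad godd]] := merge_fibres f a b d.
exists g; split.
  move=> s x; rewrite inE => /predU1P[-> | /finv fs]; last exact: gf.
  have := tfix x; rewrite !inE; case: eqP => [->|_]; first by rewrite ta.
  case: eqP => [->|_]; first by rewrite tb -gad.
  by case: eqP => [->|_] /=; [rewrite td | move/eqP->].
by rewrite doubleS -add2n addnA (leq_trans fodd) // leq_add2r.
Qed.

(** A stable set is a disjoint union of cycles, so its size would be even if all of them had even
    length. *)
Lemma odd_invariant_odd_porbit (T : finType) (s : {perm T}) (A : {set T}) :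
  (forall x, (s x \in A) = (x \in A)) ->
  odd #|A| -> exists2 x, x \in A & odd #|porbit s x|.
Proof.
move=> sA oddA; apply/exists_inP; apply: contraLR oddA => /exists_inPn evA.
have actA : [acts <[s]>, on A | 'P]%g.
  by rewrite cycle_subG; apply/astabsP=> x /=; apply: sA.
rewrite -(acts_sum_card_orbit actA) big_mkcond /= -dvdn2.
rewrite -big_mkcond dvdn_sum // => _ /imsetP[x Ax ->].
by rewrite -porbitE dvdn2 evA.
Qed.

(** Points x and y on cycles of odd lengths k and l are both fixed by the power of exponent kl,
    which is odd, so x = y. Hence there is at most one odd fibre. *)
Lemma three_cycles_lower_bound (T : finType) (s : {perm T}) (m : nat) :
  (forall k x y, odd k -> (s ^+ k)%g x = x -> (s ^+ k)%g y = y -> x = y) ->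
  prod_three_cycles s m -> #|T| <= m.*2.+1.
Proof.
move=> s1 /existsP[ts /andP[/three_cycles_fibres[f [finv fodd]] /eqP ds]].
rewrite size_tuple in fodd; apply: (leq_trans fodd).
rewrite -addn1 addnC leq_add2l.
have fs x : f (s x) = f x.
  rewrite ds; elim: (val ts) finv x => [|t r IH] finv x; first by rewrite big_nil perm1.
  rewrite big_cons permM IH => [|u y ur]; last by apply: finv; rewrite inE ur orbT.
  by apply: finv; rewrite mem_head.
have fixP v : v \in odd_fibres f -> exists2 x, f x = v & odd #|porbit s x|.
  rewrite inE => /(@odd_invariant_odd_porbit T s) [x|x]; first by rewrite !inE fs.
  by rewrite !inE => /eqP; exists x.
have fix_mul x l : (s ^+ (#|porbit s x| * l)%N)%g x = x.
  rewrite permX mulnC iterM; elim: l => //= l ->; exact: iter_porbit.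
apply/card_le1_eqP=> u v /fixP[x <- ox] /fixP[y <- oy]; congr f.
apply: (s1 (#|porbit s x| * #|porbit s y|)); first by rewrite oddM ox.
  by rewrite mulnC fix_mul.
exact: fix_mul.
Qed.

(** * Writing an even permutation with few 3-cycles *)

(** Induction on the number of moved points: factors are split off so that each 3-cycle used is paid
    for by two points that become fixed. *)
Lemma three_cycles_upper_bound (T : finType) (s : {perm T}) :
  s \in ('Alt_T)%g ->
  exists2 m, prod_three_cycles s m & m.*2 <= #|[set x | s x != x]|.
Proof.
rewrite Alt_even; have [N] := ubnP #|[set x | s x != x]|.
elim: N s => // N IH s; rewrite ltnS => leN even_s.
(* If [t] agrees with [s] on [A] and moves no point fixed by [s], then s t^-1 fixes [A] as well as
   all fixed points of [s]. *)
have step (t : {perm T}) (A : {set T}) m : prod_three_cycles t m ->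
    {in A, forall u, s u != u} -> {in A, s =1 t} ->
    (forall u, s u = u -> t u = u) -> ~~ t -> 0 < m -> m.*2 <= #|A| ->
    exists2 m, prod_three_cycles s m & m.*2 <= #|[set x | s x != x]|.
  move=> tm As Ast st et m0 leA.
  have sub : [set x | (s * t^-1)%g x != x] \subset [set x | s x != x] :\: A.
    apply/subsetP=> u; rewrite !inE permM => neq; apply/andP; split.
      by apply: contra neq => /Ast ->; rewrite permK.
    by apply: contra neq => /eqP su; rewrite su -{1}(st u su) permK.
  have := subset_leq_card sub; rewrite cardsD (setIidPr _); last first.
    by apply/subsetP=> u /As; rewrite inE.
  have leAs: #|A| <= #|[set x | s x != x]|.
    by apply/subset_leq_card/subsetP=> u /As; rewrite inE.
  have A0 : 0 < #|A| by rewrite (leq_trans _ leA) // double_gt0.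
  move=> le; have [||k pk lek] := IH (s * t^-1)%g.
  - rewrite (leq_trans _ leN) // (leq_ltn_trans le) // ltn_subrL A0.
    exact: leq_trans leAs.
  - by rewrite odd_permM odd_permV (negPf et) addbF.
  exists (k + m)%N; first by rewrite -(mulgKV t s) prod_three_cyclesM.
  by rewrite doubleD -(subnK leAs) leq_add // (leq_trans lek).
(* On a cycle of length at least 3, one 3-cycle agrees with [s] at two points. *)
have long x : s x != x -> s (s x) != x ->
    exists2 m, prod_three_cycles s m & m.*2 <= #|[set x | s x != x]|.
  move=> sx ssx; have ssxs : s (s x) != s x by rewrite (inj_eq perm_inj).
  have U : uniq [:: x; s x; s (s x)].
    by rewrite /= !inE negb_or andbT [x == _]eq_sym sx [x == _]eq_sym ssx [s x == _]eq_sym.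
  have := three_cycle_tpermM U; set t := (_ * _)%g => ct.
  have tx : t x = s x by rewrite permM tpermL tpermD // eq_sym.
  have tsx : t (s x) = s (s x) by rewrite permM tpermR tpermL.
  apply: (step t [set x; s x] 1) => //; first exact: prod_three_cycles_single.
  - by move=> u; rewrite !inE => /pred2P[]->.
  - by move=> u; rewrite !inE => /pred2P[]->.
  - move=> u su; rewrite permM.
    have neq v : s v != v -> v != u by apply: contraNneq => ->; rewrite su.
    by rewrite !tpermD ?neq // !(inj_eq perm_inj).
  - by rewrite odd_permM !odd_tperm ![x == _]eq_sym sx ssx.
  - by rewrite cards2 eq_sym sx.
have [x sx | s1] := pickP (fun x => s x != x); last first.
  exists 0%N => //; suff -> : s = 1%g by apply: prod_three_cycles1.
  by apply/permP=> x; rewrite perm1; apply/eqP/negbFE/s1.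
have [ssx | ssx] := eqVneq (s (s x)) x; last exact: long ssx.
have xs : x != s x by rewrite eq_sym.
(* [s] swaps [x] and [s x]; being even, it differs from that transposition, so another point [z] is
   moved. *)
have [z | s1] := pickP (fun z => (s * tperm x (s x))%g z != z); last first.
  have s1' : (s * tperm x (s x))%g = 1%g.
    by apply/permP=> z; rewrite perm1; apply/eqP/negbFE/s1.
  by have := odd_permM s (tperm x (s x)); rewrite s1' odd_perm1 odd_tperm xs (negPf even_s).
rewrite permM => neqz.
have zx : z != x by apply: contraNneq neqz => ->; rewrite tpermR.
have zsx : z != s x by apply: contraNneq neqz => ->; rewrite ssx tpermL.
have szx : s z != x by rewrite -ssx (inj_eq perm_inj).
have szsx : s z != s x by rewrite (inj_eq perm_inj).
have sz : s z != z by move: neqz; rewrite tpermD // eq_sym.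
have [ssz | ssz] := eqVneq (s (s z)) z; last exact: long ssz.
have c1 : three_cycle (tperm x (s x) * tperm x z).
  by apply: three_cycle_tpermM; rewrite /= !inE !negb_or andbT xs ![_ == z]eq_sym zx zsx.
have c2 : three_cycle (tperm z x * tperm z (s z)).
  by apply: three_cycle_tpermM; rewrite /= !inE !negb_or andbT ![_ == s z]eq_sym zx sz szx.
(* Inserting (x z)(z x) between the two transpositions turns their product into two 3-cycles, paid
   for by four points. *)
pose t := (tperm x (s x) * tperm z (s z))%g.
have tE : t = (tperm x (s x) * tperm x z * (tperm z x * tperm z (s z)))%g.
  by rewrite (tpermC z x) -mulgA [(tperm x z * (_ * _))%g]mulgA tperm2 mul1g.
apply: (step t [set x; s x; z; s z] 2) => //.
- rewrite tE; apply: (prod_three_cyclesM (m := 1) (k := 1)); exact: prod_three_cycles_single.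
- by move=> u; rewrite !inE -!orbA => /or4P[] /eqP->; rewrite ?ssx ?ssz // eq_sym.
- move=> u; rewrite !inE -!orbA permM => /or4P[] /eqP->.
  + by rewrite tpermL tpermD.
  + by rewrite tpermR ssx tpermD // eq_sym.
  + by rewrite (@tpermD _ x) ?tpermL // eq_sym.
  + by rewrite (@tpermD _ x) ?tpermR // eq_sym.
- move=> u su; have neq v : s v != v -> v != u by apply: contraNneq => ->; rewrite su.
  by rewrite permM !tpermD ?neq // !(inj_eq perm_inj).
- by rewrite odd_permM !odd_tperm xs eq_sym sz.
- rewrite -!setUA !cardsU1 cards1 !inE !negb_or xs ![x == _]eq_sym ![s x == _]eq_sym.
  by rewrite zx szx zsx szsx eq_sym sz.
Qed.
Lemma odd_perm_prod_lift (T U V : finType) (L : V -> T * U) (K : T * U -> V)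
    (s : {perm T}) (w : {perm V}) :
  cancel L K -> cancel K L ->
  (forall v, L (w v) = (s (L v).1, (L v).2)) -> odd_perm w = odd_perm s && odd #|U|.
Proof.
move=> LK KL; case: (prod_tpermP s) => ts -> {s}.
elim: ts w => [|[x y] ts IH] w /=.
  rewrite big_nil odd_perm1 => _ wE; suff -> : w = 1%g by rewrite odd_perm1.
  by apply/permP=> v; apply: (can_inj LK); rewrite wE !perm1; case: (L v).
move=> /andP[/= xy dts]; rewrite big_cons => wE.
pose w1 := (\prod_(u <- enum U) tperm (K (x, u)) (K (y, u)))%g.
have w1E v : L (w1 v) = (tperm x y (L v).1, (L v).2).
  have prodE (r : seq U) : uniq r -> forall v,
      L ((\prod_(u <- r) tperm (K (x, u)) (K (y, u)))%g v)
      = if (L v).2 \in r then (tperm x y (L v).1, (L v).2) else L v.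
    elim: r => [_ v'|u r IHr /= /andP[ur Ur] v']; first by rewrite big_nil perm1.
    rewrite big_cons permM IHr // inE; case: tpermP => [->|->|neqx neqy].
    - by rewrite !KL /= eqxx (negPf ur) tpermL.
    - by rewrite !KL /= eqxx (negPf ur) tpermR.
    - case: eqP => //= eu; rewrite eu (negPf ur) tpermD.
      + by rewrite -eu; case: (L v').
      + by apply: contra_notN neqx => /eqP->; rewrite -eu -surjective_pairing LK.
      + by apply: contra_notN neqy => /eqP->; rewrite -eu -surjective_pairing LK.
  by rewrite prodE ?enum_uniq // mem_enum.
have w1odd : odd_perm w1 = odd #|U|.
  rewrite /w1 cardE -sum1_size; elim/big_rec2: _ => [|u k p _ IHp]; first exact: odd_perm1.
  by rewrite odd_mul_tperm oddD IHp (can_eq KL) xpair_eqE (negPf xy).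
have -> : w = (w1 * (w1^-1 * w))%g by rewrite mulKVg.
rewrite odd_mul_tperm odd_permM w1odd xy (IH (w1^-1 * w)%g) //.
  by case: odd; case: odd_perm.
move=> v; rewrite permM wE /=; set v1 := w1^-1%g v.
have -> : v = w1 v1 by rewrite permKV.
by rewrite w1E permM.
Qed.

Definition mulmod_fun (a n : nat) (x : 'I_n) : 'I_n :=
  Ordinal (ltn_pmod (a * x) (leq_ltn_trans (leq0n x) (ltn_ord x))).

(** The identity is the default when x |-> a x is not injective modulo n. The carrier is ['I_n]
    rather than ['Z_n] so that the modulus 1, reached as [n ^ 0], really has one point. *)
Definition mulmod_perm (a n : nat) : {perm 'I_n} :=
  insubd (1%g : {perm 'I_n}) [ffun x => mulmod_fun a x].

Lemma eqn_coprime_modMl a n x y :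
  coprime n a -> (a * x == a * y %[mod n]) = (x == y %[mod n]).
Proof.
move=> co_na; wlog le_xy: x y / x <= y.
  by move=> IH; case/orP: (leq_total x y) => /IH // E; rewrite eq_sym E eq_sym.
rewrite eq_sym [RHS]eq_sym !eqn_mod_dvd ?leq_mul2l ?le_xy ?orbT //.
by rewrite -mulnBr Gauss_dvdr.
Qed.

Lemma mulmod_permE a n (x : 'I_n) :
  coprime n a -> mulmod_perm a n x = a * x %% n :> nat.
Proof.
move=> co_na; rewrite /mulmod_perm -pvalE val_insubd; case: injectiveP => [_|[]].
  by rewrite ffunE.
move=> u v; rewrite !ffunE => /(congr1 val) /= /eqP.
by rewrite eqn_coprime_modMl // !modn_small // => /eqP/val_inj.
Qed.

Lemma odd_permX (T : finType) (s : {perm T}) m :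
  odd_perm (s ^+ m)%g = odd m && odd_perm s.
Proof.
elim: m => [|m IH]; first by rewrite expg0 odd_perm1.
by rewrite expgS odd_permM IH oddS; case: odd; case: odd_perm.
Qed.

Lemma even_perm_odd_order (T : finType) (s : {perm T}) m :
  odd m -> (s ^+ m)%g = 1%g -> odd_perm s = false.
Proof. by move=> om sm; have := odd_permX s m; rewrite sm odd_perm1 om. Qed.

(* Writing x = r + n * t with r < n and t < m, multiplication by a on Z/nm
   becomes (r, t) |-> (a r mod n, a t + k_r mod m): up to the shear by k_r, which
   has odd order, it is a product of the multiplications on Z/n and Z/m. *)
Lemma odd_mulmod_permM a n m :
  odd n -> odd m -> coprime (n * m) a ->
  odd_perm (mulmod_perm a (n * m))
  = odd_perm (mulmod_perm a n) (+) odd_perm (mulmod_perm a m).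
Proof.
move=> on om; rewrite coprimeMl => /andP[co_na co_ma].
have n0 := odd_gt0 on; have m0 := odd_gt0 om.
have L2 (x : 'I_(n * m)) : x %/ n < m by rewrite ltn_divLR // [m * n]mulnC.
have K0 (u : 'I_n * 'I_m) : u.1 + n * u.2 < n * m.
  rewrite (leq_trans (n := n * u.2.+1)) ?leq_mul2l ?ltn_ord ?orbT //.
  by rewrite mulnS ltn_add2r.
pose L (x : 'I_(n * m)) : 'I_n * 'I_m := (Ordinal (ltn_pmod x n0), Ordinal (L2 x)).
pose K u : 'I_(n * m) := Ordinal (K0 u).
have LK : cancel L K by move=> x; apply: val_inj; rewrite /= addnC mulnC -divn_eq.
have KL : cancel K L.
  case=> r t; congr (_, _); apply: val_inj => /=.
    by rewrite addnC mulnC modnMDl modn_small.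
  by rewrite addnC mulnC divnMDl // divn_small // addn0.
have lift_inj (f : 'I_n * 'I_m -> 'I_n * 'I_m) : injective f -> injective (K \o f \o L).
  move=> fI; apply: inj_comp; last exact: can_inj LK.
  by apply: inj_comp => //; apply: can_inj KL.
pose sn := mulmod_perm a n; pose sm := mulmod_perm a m.
have fA : injective (fun u : 'I_n * 'I_m => (sn u.1, u.2)).
  by move=> [r t] [r' t'] [/perm_inj-> ->].
have fB : injective (fun u : 'I_n * 'I_m => (u.1, sm u.2)).
  by move=> [r t] [r' t'] [-> /perm_inj->].
pose A := perm (lift_inj _ fA); pose B := perm (lift_inj _ fB).
have AE v : L (A v) = (sn (L v).1, (L v).2) by rewrite permE /= KL.
have BE v : L (B v) = ((L v).1, sm (L v).2) by rewrite permE /= KL.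
have oA : odd_perm A = odd_perm sn by rewrite (odd_perm_prod_lift LK KL AE) card_ord om andbT.
have oB : odd_perm B = odd_perm sm.
  pose sw (T U : Type) (u : T * U) := (u.2, u.1).
  have swK T U : cancel (sw T U) (sw U T) by case.
  rewrite (@odd_perm_prod_lift _ _ _ (sw _ _ \o L) (K \o sw _ _) sm).
  - by rewrite card_ord on andbT.
  - exact: can_comp.
  - exact: can_comp.
  - by move=> v; rewrite /= BE.
pose w := mulmod_perm a (n * m); pose C := ((B * A)^-1 * w)%g.
have wE : w = (B * A * C)%g by rewrite mulKVg.
have L1 x : (L x).1 = x %% n :> nat by [].
(* [C] acts after [A] has multiplied the remainder by a, so the carry is computed from the preimage
   of [r] under [sn]. *)
pose k (r : 'I_n) := a * (sn^-1)%g r %/ n.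
have CE v : (L (C v)).1 = (L v).1
            /\ (L (C v)).2 = (L v).2 + k (L v).1 %[mod m].
  have [u ->] : exists u, v = A (B u).
    by exists ((B * A)^-1 v)%g; rewrite -permM permKV.
  have -> : C (A (B u)) = w u by rewrite wE !permM.
  rewrite AE BE /k /= permK; split.
    apply: val_inj; rewrite /= !mulmod_permE ?coprimeMl ?co_na //.
    by rewrite modn_dvdm ?dvdn_mulr // modnMmr.
  rewrite !mulmod_permE ?coprimeMl ?co_na //= modnDml.
  have -> : a * u %% (n * m) %/ n = a * u %/ n %% m by rewrite modn_divl (mulnC m).
  rewrite modn_mod.
  by rewrite {1}(divn_eq u n) mulnDr mulnA divnMDl.
have CX i v : (L ((C ^+ i)%g v)).1 = (L v).1
              /\ (L ((C ^+ i)%g v)).2 = (L v).2 + i * k (L v).1 %[mod m].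
  elim: i => [|i [IH1 IH2]]; first by rewrite expg0 perm1 mul0n addn0.
  rewrite expgSr permM; have [-> ->] := CE ((C ^+ i)%g v); rewrite IH1; split=> //.
  by rewrite -modnDml IH2 modnDml -addnA mulSnr.
have Cm : (C ^+ m = 1)%g.
  apply/permP=> v; apply: (can_inj LK); rewrite perm1; have [e1 e2] := CX m v.
  rewrite [LHS]surjective_pairing [RHS]surjective_pairing e1; congr (_, _).
  by apply: val_inj; move: e2; rewrite [m * k _]mulnC addnC modnMDl !modn_small.
by rewrite -/w wE odd_permM (even_perm_odd_order om Cm) addbF odd_permM oA oB addbC.
Qed.
Lemma mulmod_permM a b n :
  coprime n a -> coprime n b ->
  mulmod_perm (a * b) n = (mulmod_perm a n * mulmod_perm b n)%g.
Proof.
move=> co_na co_nb; apply/permP=> x; apply: val_inj.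
by rewrite permM /= !mulmod_permE ?coprimeMr ?co_na // modnMmr mulnA (mulnC b).
Qed.

Lemma mulmod_perm_mod a b n :
  coprime n a -> a = b %[mod n] -> mulmod_perm a n = mulmod_perm b n.
Proof.
move=> co_na ab; have co_nb : coprime n b by rewrite -coprime_modr -ab coprime_modr.
by apply/permP=> x; apply: val_inj; rewrite /= !mulmod_permE // -modnMml ab modnMml.
Qed.

Lemma odd_mulmod_permX a n c :
  odd n -> coprime n a ->
  odd_perm (mulmod_perm a (n ^ c)) = odd (c * odd_perm (mulmod_perm a n)).
Proof.
move=> on co_na; elim: c => [|c IH].
  by rewrite (_ : mulmod_perm a _ = 1%g) ?odd_perm1 //; apply/permP=> x; rewrite !ord1.
rewrite expnS odd_mulmod_permM ?oddX ?on ?orbT //; last first.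
  by rewrite -expnS coprimeXl.
by rewrite IH mulSn oddD oddb.
Qed.

Lemma odd_mulmod_perm_prod (I : finType) (p c : I -> nat) a :
  (forall i, odd (p i)) -> (forall i, coprime (p i) a) ->
  odd_perm (mulmod_perm a (\prod_i p i ^ c i))
  = odd (\sum_i c i * odd_perm (mulmod_perm a (p i))).
Proof.
move=> op co_pa.
(* Multiplicativity of the sign requires odd moduli coprime to [a], so both properties are carried
   along the product. *)
pose P n m := [/\ odd n, coprime n a & odd_perm (mulmod_perm a n) = odd m].
suff [] : P (\prod_i p i ^ c i) (\sum_i c i * odd_perm (mulmod_perm a (p i))) by [].
apply: big_ind2 => [|n1 m1 n2 m2 [o1 co1 e1] [o2 co2 e2]|i _].
- by have := odd_mulmod_permX (n := 1) 0 isT (coprime1n a); split; rewrite ?coprime1n.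
- have co12 : coprime (n1 * n2) a by rewrite coprimeMl co1.
  by split; rewrite ?oddM ?o1 // odd_mulmod_permM // oddD e1 e2.
- by split; rewrite ?oddX ?op ?orbT ?coprimeXl // odd_mulmod_permX.
Qed.

(** * Multipliers of even order modulo a prime *)

(** A generator of the cyclic group of units of ['F_p], which has order p - 1, is read as a natural
    number. *)
Lemma primitive_root_nat p : prime p ->
  exists g, [/\ coprime p g, forall k, g ^ k = 1 %[mod p] -> p.-1 %| k
    & forall x, coprime p x -> exists i, x = g ^ i %[mod p]].
Proof.
move=> pr_p; have /cyclicP[u Du] := field_unit_group_cyclic [set: {unit 'F_p}].
have valE (x y : nat) : x%:R%R = y%:R%R :> 'F_p -> x = y %[mod p].
  by move/(congr1 (@nat_of_ord _)); rewrite !val_Fp_nat.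
have gE : (val u : 'F_p)%:R%R = val u by rewrite natr_Zp.
exists (val u : 'F_p); split.
- by rewrite -unitFpE // gE (valP u).
- move=> k /eqP; rewrite -(eqP (_ : #[u]%g == p.-1)); last first.
    by rewrite /order -Du card_finField_unit card_Fp.
  rewrite order_dvdn => /eqP gk; apply/eqP/val_inj.
  rewrite FinRing.val_unitX -gE -GRing.natrX; apply: val_inj.
  by rewrite /= val_Fp_nat // gk modn_small ?prime_gt1.
- move=> x co_px; have Ux : x%:R%R \is a @GRing.unit 'F_p by rewrite unitFpE.
  have /cycleP[i Di] : FinRing.unit 'F_p Ux \in <[u]>%g by rewrite -Du inE.
  exists i; apply: valE; rewrite GRing.natrX gE.
  by move/(congr1 val): Di => /= ->; rewrite FinRing.val_unitX.
Qed.

(** There are exactly two cycles, {0} and the nonzero residues, on an odd number of points; the sign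
    is the parity of the difference. *)
Lemma odd_mulmod_perm_primitive p g :
  prime p -> odd p -> coprime p g ->
  (forall x, coprime p x -> exists i, x = g ^ i %[mod p]) ->
  odd_perm (mulmod_perm g p).
Proof.
move=> pr_p op co_pg gen; set s := mulmod_perm g p.
have sX i x : (s ^+ i)%g x = g ^ i * x %% p :> nat.
  elim: i => [|i IH]; first by rewrite expg0 perm1 mul1n modn_small.
  by rewrite expgSr permM mulmod_permE // IH modnMmr mulnA -expnS.
pose x0 := Ordinal (prime_gt0 pr_p); pose x1 := Ordinal (prime_gt1 pr_p).
have fix0 i : (s ^+ i)%g x0 = x0 by apply: val_inj; rewrite /= sX muln0 mod0n.
rewrite /odd_perm card_ord op; suff -> : porbits s = [set porbit s x0; porbit s x1].
  rewrite cards2; case: eqP => // /eqP; rewrite eq_sym eq_porbit_mem.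
  by case/porbitP=> i; rewrite fix0.
apply/setP=> X; rewrite !inE; apply/imsetP/orP => [[x _ ->]|[]/eqP->]; try by eexists.
have [->|x_neq0] := eqVneq x x0; [by left | right].
have [i xi] : exists i, x = g ^ i %[mod p].
  apply: gen; rewrite prime_coprime // gtnNdvd ?ltn_ord // lt0n.
  by apply: contraNneq x_neq0 => x0E; apply/eqP/val_inj.
rewrite eq_porbit_mem; apply/porbitP; exists i; apply: val_inj.
by rewrite /= sX muln1 -xi modn_small.
Qed.

(** [b] prescribes the sign: a primitive root gives an odd permutation, its square an even one. *)
Lemma prime_even_order p (b : bool) :
  prime p -> odd p -> b || (p %% 4 == 1) ->
  exists a, [/\ coprime p a, forall k, odd k -> a ^ k != 1 %[mod p]
    & odd_perm (mulmod_perm a p) = b].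
Proof.
move=> pr_p op; have [g [co_pg ordg gen]] := primitive_root_nat pr_p.
have odd_s := odd_mulmod_perm_primitive pr_p op co_pg gen.
case: b => [_ | /= p14].
  exists g; split=> // k ok; apply/eqP=> /ordg/dvdn_odd/(_ ok).
  by case: p op {pr_p co_pg ordg gen odd_s} => //= p /negPf->.
exists (g * g); split; first by rewrite coprimeMr co_pg.
  (* Here p - 1 divides 2k and 4 divides p - 1, so k is even. *)
  move=> k; apply: contraTneq; rewrite mulnn -expnM => /ordg p1k.
  have: 4 %| 2 * k by apply: dvdn_trans p1k; rewrite -subn1 -eqn_mod_dvd ?prime_gt0.
  by rewrite (@dvdn_pmul2l 2 2 k) // dvdn2.
by rewrite mulmod_permM // odd_permM addbb.
Qed.

(** * Combining residues, and fixed points of affine maps *)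

Lemma chinese_seq (I : eqType) (r : seq I) (p g : I -> nat) :
  uniq r -> {in r &, forall i j, i != j -> coprime (p i) (p j)} ->
  exists a, {in r, forall i, a = g i %[mod p i]}.
Proof.
elim: r => [|i r IH] /=; first by exists 0.
move=> /andP[ir Ur] co_p; case: IH => // [j k rj rk|a aE].
  by apply: co_p; rewrite inE ?rj ?rk orbT.
have co_pi : coprime (p i) (\prod_(j <- r) p j).
  rewrite big_seq; elim/big_ind: _ => [|m k co_m co_k|j rj]; first exact: coprimen1.
    by rewrite coprimeMr co_m.
  by apply: co_p; rewrite ?inE ?eqxx ?rj ?orbT //; apply: contraNneq ir => ->.
exists (chinese (p i) (\prod_(j <- r) p j) (g i) a) => j.
rewrite inE => /predU1P[->|rj]; first by rewrite chinese_modl.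
have pj : p j %| \prod_(j <- r) p j by rewrite (big_rem j) //= dvdn_mulr.
by rewrite -(modn_dvdm _ pj) chinese_modr // modn_dvdm // aE.
Qed.

(** The translation [b] cancels in differences, so the k-th power multiplies x - y by a^k; for two
    fixed points the unit a^k - 1 then kills x - y. *)
Lemma affine_odd_fixpoints a n (s : {perm 'Z_n}) (b : 'Z_n) :
  1 < n -> (forall k, odd k -> coprime n (a ^ k - 1)) -> 0 < a ->
  (forall x, s x = a%:R * x + b)%R ->
  forall k x y, odd k -> (s ^+ k)%g x = x -> (s ^+ k)%g y = y -> x = y.
Proof.
move=> n1 co_na a0 sE k x y ok sx sy; apply/eqP; rewrite -GRing.subr_eq0.
have skB : ((s ^+ k)%g x - (s ^+ k)%g y = (a ^ k)%:R * (x - y))%R.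
  elim: k {ok sx sy} => [|k IH]; first by rewrite !perm1 GRing.mul1r.
  rewrite !expgSr !permM !sE GRing.opprD GRing.addrACA GRing.subrr GRing.addr0.
  by rewrite -GRing.mulrBr IH expnS GRing.natrM GRing.mulrA.
have z0 : ((a ^ k - 1)%:R * (x - y) = 0)%R.
  rewrite GRing.natrB ?expn_gt0 ?a0 // GRing.mulrBl -skB sx sy.
  by rewrite GRing.mul1r GRing.subrr.
have U : (a ^ k - 1)%:R%R \is a @GRing.unit 'Z_n by rewrite unitZpE ?co_na.
by rewrite -(GRing.mulKr U (x - y)%R) z0 GRing.mulr0.
Qed.

(** * The value of h *)

(** The upper bound holds for every even permutation, taken as its own coset representative.
    Multiplication by [a] attains it, since every element of its coset is even and affine of slope
    [a]. *)
Lemma h_eq_half n a :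
  1 < n -> odd n -> coprime n a -> (forall k, odd k -> coprime n (a ^ k - 1)) ->
  ~~ odd_perm (mulmod_perm a n) -> h n = (n - 1) %/ 2.
Proof.
move=> n1 on co_na co_nak even_a; have nE := Zp_cast n1.
have a0 : 0 < a.
  rewrite lt0n; apply: contraTneq co_na => ->.
  by rewrite /coprime gcdn0 gtn_eqF.
have n_half : n = ((n - 1) %/ 2).*2.+1.
  by case: n on {n1 co_na co_nak even_a nE} => // m om; rewrite subn1 divn2 even_halfK.
have cardZ : #|'Z_n| = n by rewrite card_ord.
have hpermP (s : {perm 'Z_n}) : s \in ('Alt_('Z_n))%g ->
    prod_three_cycles s (hperm s) /\ forall m, prod_three_cycles s m -> hperm s <= m.
  by rewrite /hperm => As; case: ex_minnP => m; rewrite As.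
have cE x : cshift n x = (x + 1)%R by rewrite permE.
have cX j x : (cshift n ^+ j)%g x = (x + j%:R)%R.
  elim: j => [|j IH]; first by rewrite perm1 GRing.addr0.
  by rewrite expgSr permM cE IH -GRing.addrA GRing.natr1.
(* The shift has odd order n, so composing with its powers preserves the sign. *)
have even_c : ~~ odd_perm (cshift n).
  rewrite (even_perm_odd_order on) //; apply/permP=> x.
  by rewrite cX perm1 pchar_Zp // GRing.addr0.
apply/eqP; rewrite eqn_leq; apply/andP; split.
  apply/bigmax_leqP=> s As; apply: (@leq_trans (hperm s)).
    rewrite /hcoset; case: arg_minnP => [|t _]; first exact: rcoset_refl.
    by apply; exact: rcoset_refl.
  have [m /(proj2 (hpermP _ As)) le_m m2] := three_cycles_upper_bound As.
  rewrite (leq_trans le_m) // -leq_double -ltnS -n_half -cardZ.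
  (* Twice the number of 3-cycles is at most n, and n is odd, so the inequality is strict. *)
  rewrite ltn_neqAle (leq_trans m2 (max_card _)) andbT.
  by apply: contraTneq on => e; rewrite -cardZ -e odd_double.
(* [(Zp_trunc n).+2] is the modulus built into the type ['Z_n]; it equals n because 1 < n. *)
pose pi := mulmod_perm a (Zp_trunc n).+2.
have piE x : pi x = (a%:R * x)%R.
  rewrite -[x in RHS]natr_Zp -GRing.natrM; apply: ord_inj.
  by rewrite val_Zp_nat // mulmod_permE ?nE //; congr (_ %% _).
have Api : pi \in ('Alt_('Z_n))%g by rewrite Alt_even /pi nE.
apply: leq_trans (leq_bigmax_cond _ Api).
rewrite /hcoset; case: arg_minnP => [|t]; first exact: rcoset_refl.
case/rcosetP=> u /cycleP[j ->] -> _; set s := (_ * _)%g.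
have As : s \in ('Alt_('Z_n))%g.
  by rewrite Alt_even odd_permM odd_permX (negPf even_c) andbF -Alt_even.
have [ps _] := hpermP _ As.
rewrite -leq_double -ltnS -n_half -{1}cardZ.
apply: three_cycles_lower_bound ps.
(* The shift acts first: x goes to a(x + j), which has constant term a j. *)
apply: (@affine_odd_fixpoints a n s (a%:R * j%:R)%R) => // x.
by rewrite permM cX piE GRing.mulrDr.
Qed.

Theorem theorem3p9 (n k : nat) (p c : 'I_k -> nat)
    (k_gt0 : 0 < k)
    (p_inj : injective p)
    (p_prime : forall i, prime (p i))
    (p_odd : forall i, odd (p i))
    (c_gt0 : forall i, 0 < c i)
    (n_eq : n = \prod_(i < k) p i ^ c i)
    (cond : ~~ odd (\sum_(i < k) c i)
         \/ odd (\sum_(i < k) c i)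
            /\ (exists l : 'I_k, p l = 1 %[mod 4] /\ odd (c l))) :
  h n = (n - 1) %/ 2.
Proof.
(* [b i] is the sign wanted modulo p_i, true meaning odd; the sign modulo n is then the parity of
   the displayed sum. Under (ii), switching off the odd exponent c_l makes that sum even. *)
have [b bP even_sum] : exists2 b : 'I_k -> bool,
    forall i, b i || (p i %% 4 == 1) & ~~ odd (\sum_(i < k) c i * b i).
  case: cond => [ev | [od [l [pl1 cl]]]].
    by exists xpredT => //; under eq_bigr do rewrite muln1.
  exists (predC1 l) => [i /=|]; first by case: eqP => //= ->; rewrite pl1.
  rewrite (bigD1 l) //= eqxx muln0; move: od; rewrite (bigD1 l) //= oddD cl.
  by under [in X in _ -> X]eq_bigr => i il do rewrite il muln1.
have /fin_all_exists[g gP] i := prime_even_order (p_prime i) (p_odd i) (bP i).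
(* Residues modulo the primes p_i suffice: coprimality to n and the sign modulo n depend on nothing
   else. *)
have [a aE] : exists a, {in index_enum 'I_k, forall i, a = g i %[mod p i]}.
  apply: chinese_seq => [|i j _ _ ij]; first exact: index_enum_uniq.
  by rewrite prime_coprime // dvdn_prime2 // (inj_eq p_inj).
have {}aE i : a = g i %[mod p i] by apply: aE; exact: mem_index_enum.
have co_pa i : coprime (p i) a.
  by have [co_pg _ _] := gP i; rewrite -coprime_modr aE coprime_modr.
have dvd_pn i : p i %| n by rewrite n_eq (bigD1 i) //= dvdn_mulr ?dvdn_exp.
have n_gt0 : 0 < n by rewrite n_eq prodn_gt0 // => i; rewrite expn_gt0 prime_gt0.
have n_gt1 : 1 < n.
  by apply: leq_trans (dvdn_leq n_gt0 (dvd_pn (Ordinal k_gt0))); exact: prime_gt1.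
have coP x : (forall i, coprime (p i) x) -> coprime n x.
  move=> co_x; rewrite n_eq; elim/big_ind: _ => [|y z cy cz|i _]; first exact: coprime1n.
    by rewrite coprimeMl cy.
  exact: coprimeXl.
have a_gt0 : 0 < a.
  rewrite lt0n; apply: contraTneq (co_pa (Ordinal k_gt0)) => ->.
  by rewrite /coprime gcdn0 gtn_eqF ?prime_gt1.
apply: (@h_eq_half n a) => //.
- by rewrite n_eq; elim/big_ind: _ => // [x y ox oy|i _]; rewrite ?oddM ?ox // oddX p_odd orbT.
- exact: coP.
- move=> j oj; apply: coP => i; rewrite prime_coprime // -eqn_mod_dvd ?expn_gt0 ?a_gt0 //.
  by have [_ /(_ j oj) + _] := gP i; rewrite -modnXm -aE modnXm.
- rewrite n_eq odd_mulmod_perm_prod //.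
  under eq_bigr => i _.
    have [_ _ gb] := gP i; rewrite (mulmod_perm_mod (co_pa i) (aE i)) gb; over.
  by [].
Qed.
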